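(* Let $\mathcal H$ be a Hilbert space, let $\mathfrak a$ be a densely defined, non-negative, closed sesquilinear form in $\mathcal H$, and let $A$ be the non-negative self-adjoint operator associated with $\mathfrak a$, so that $\mathrm{Dom}[\mathfrak a]=\mathrm{Dom}(A^{1/2})$ and $\mathfrak a[x,y]=\langle A^{1/2}x,A^{1/2}y\rangle$. Let $J_A$ be a self-adjoint involution commuting with $A$. Let $\mathfrak v$ be a symmetric sesquilinear form with $\mathrm{Dom}[\mathfrak v]\supseteq\mathrm{Dom}[\mathfrak a]$ such that there is a finite constant $\beta$ with $$|\mathfrak v[x]|\le\beta\,\|(A+I)^{1/2}x\|^2=\beta(\mathfrak a+I)[x],\qquad x\in\mathrm{Dom}(A^{1/2}),$$ and such that $$\mathfrak v[J_Ax,y]=-\mathfrak v[x,J_Ay]\quad\text{for all }x,y\in\mathrm{Dom}[\mathfrak a].$$ Let $\mathfrak b$ be the symmetric sesquilinear form on $\mathrm{Dom}[\mathfrak b]=\mathrm{Dom}[\mathfrak a]$ given by $$\mathfrak b[x,y]:=\mathfrak a[x,J_Ay]+\mathfrak v[x,y].$$ Then there exists a unique self-adjoint operator $B$ with $\mathrm{Dom}(B)\subseteq\mathrm{Dom}[\mathfrak b]$ such that $$\mathfrak b[x,y]=\langle x,By\rangle\quad\text{for all }x\in\mathrm{Dom}[\mathfrak a],\ y\in\mathrm{Dom}(B).$$ Furthermore, $\mathrm{Dom}(B)$ is a form core for $\mathfrak a$, that is, $\mathrm{Dom}(B)$ is dense in $\mathrm{Dom}[\mathfrak a]$ with respect to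 the norm $\sqrt{(\mathfrak a+I)[\,\cdot\,]}$.
   Context: A self-adjoint involution is a bounded self-adjoint operator $J$ with $J^2=I$; it commutes with a self-adjoint operator $A$ if $J\,\mathrm{Dom}(A)\subseteq\mathrm{Dom}(A)$ and $JAx=AJx$ for all $x\in\mathrm{Dom}(A)$. For a form $\mathfrak v$, $\mathfrak v[x]:=\mathfrak v[x,x]$, and $(\mathfrak a+I)[x,y]:=\mathfrak a[x,y]+\langle x,y\rangle$. *)

(* Defs.v *)
From HB Require Import structures.
From mathcomp Require Import all_boot all_order all_algebra.
From mathcomp Require Import sesquilinear complex.
From mathcomp Require Import boolp classical_sets reals topology normedtype.

Set Implicit Arguments.
Unset Strict Implicit.
Unset Printing Implicit Defensive.

Import Order.TTheory GRing.Theory Num.Theory.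
Local Open Scope classical_set_scope.
Local Open Scope ring_scope.

(* The order on R[i] is partial: 0 <= z entails that z is real. *)
HB.mixin Record CompleteNormedModule_isHilbert (R : realType) H
    of CompleteNormedModule R[i] H := {
  inner : {dot H for (@Num.conj R[i])} ;
  normr_inner : forall x : H, `|x| ^+ 2 = inner x x
}.

#[short(type="hilbertType")]
HB.structure Definition Hilbert (R : realType) :=
  { H of CompleteNormedModule R[i] H & CompleteNormedModule_isHilbert R H }.

Section Operators.
Variables (R : realType) (H : hilbertType R).
Implicit Types (x y z : H) (c : R[i]).

(* Partial operators and forms. The values outside the domain carry no meaning
   and are ignored by every definition below. *)
Record operator := Operator { odom : set H ; opfun :> H -> H }.

Record sform := SForm { fdom : set H ; formfun :> H -> H -> R[i] }.

Definition same_operator (S T : operator) : Prop :=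
  odom S = odom T /\ {in odom S, S =1 T}.

Definition linear_operator (T : operator) : Prop :=
  submod_closed [in odom T] /\
  (forall c x y, x \in odom T -> y \in odom T -> T (c *: x + y) = c *: T x + T y).

(* (y, z) belongs to the graph of the adjoint of T, for densely defined T *)
Definition adjoint_graph (T : operator) y z : Prop :=
  forall x, x \in odom T -> inner (T x) y = inner x z.

Definition selfadjoint (T : operator) : Prop :=
  [/\ linear_operator T, dense (odom T) &
      forall y z, adjoint_graph T y z <-> y \in odom T /\ T y = z].

Definition nonneg_operator (T : operator) : Prop :=
  forall x, x \in odom T -> 0 <= inner (T x) x.

(* S = T^(1/2); the domain of S^2 is {x in Dom S | S x in Dom S}. *)
Definition is_sqrt_operator (T S : operator) : Prop :=
  [/\ selfadjoint S, nonneg_operator S &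
      same_operator T (Operator [set x | x \in odom S /\ S x \in odom S] (S \o S))].

(* Sesquilinear forms are, like the inner product, linear in the first and
   conjugate-linear in the second argument. *)
Definition sesquilinear_sform (q : sform) : Prop :=
  [/\ submod_closed [in fdom q],
      forall c x y z, x \in fdom q -> y \in fdom q -> z \in fdom q ->
        q (c *: x + y) z = c * q x z + q y z &
      forall c x y z, x \in fdom q -> y \in fdom q -> z \in fdom q ->
        q z (c *: x + y) = c^* * q z x + q z y].

Definition symmetric_sform (q : sform) : Prop :=
  forall x y, x \in fdom q -> y \in fdom q -> q x y = (q y x)^*.

Definition nonneg_sform (q : sform) : Prop :=
  forall x, x \in fdom q -> 0 <= q x x.

Definition closed_sform (q : sform) : Prop :=
  forall (u : nat -> H) x,
    (forall n, u n \in fdom q) ->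
    u @ \oo --> x ->
    (forall e : R, 0 < e -> exists N : nat, forall n m : nat,
       (N <= n)%N -> (N <= m)%N -> q (u n - u m) (u n - u m) < e%:C%C) ->
    x \in fdom q /\
    (forall e : R, 0 < e -> exists N : nat, forall n : nat,
       (N <= n)%N -> q (u n - x) (u n - x) < e%:C%C).

Definition form_add1 (q : sform) : sform :=
  SForm (fdom q) (fun x y => q x y + inner x y).

Definition associated (q : sform) (T : operator) : Prop :=
  exists S : operator, [/\ is_sqrt_operator T S, fdom q = odom S &
    forall x y, x \in fdom q -> y \in fdom q -> q x y = inner (S x) (S y)].

Definition selfadjoint_involution (J : {linear H -> H}) : Prop :=
  [/\ exists M : R, forall x, `|J x| <= M%:C%C * `|x|,
      forall x y, inner (J x) y = inner x (J y) &
      forall x, J (J x) = x].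

Definition commutes_with (J : {linear H -> H}) (T : operator) : Prop :=
  (forall x, x \in odom T -> J x \in odom T) /\
  (forall x, x \in odom T -> J (T x) = T (J x)).

(* In the intended use J is a self-adjoint involution commuting with the
   operator associated with a, so that J maps the domain of a into itself. *)
Definition indefinite_form (a v : sform) (J : {linear H -> H}) : sform :=
  SForm (fdom a) (fun x y => a x (J y) + v x y).

Definition represents (b : sform) (T : operator) : Prop :=
  [/\ selfadjoint T, odom T `<=` fdom b &
      forall x y, x \in fdom b -> y \in odom T -> b x y = inner x (T y)].

Definition form_norm (q : sform) x : R[i] := sqrtC (form_add1 q x x).

Definition form_core (q : sform) (D : set H) : Prop :=
  D `<=` fdom q /\
  (forall x, x \in fdom q -> forall e : R, 0 < e ->
     exists2 y, y \in D & form_norm q (x - y) < e%:C%C).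

End Operators.

(* Main.v *)
Require Import Defs.
From HB Require Import structures.
From mathcomp Require Import all_boot all_order all_algebra.
From mathcomp Require Import sesquilinear complex.
From mathcomp Require Import boolp classical_sets reals topology normedtype.
From mathcomp Require Import ring lra.

(** The form domain V = Dom[a] is a Hilbert space for the inner product
q[x,y] = a[x,y] + <x,y>, because a is closed, and every form in the statement
can be read in it. Riesz representations in V turn the problem into one about
bounded operators on V.

The involution J maps V into itself and is q-symmetric there
([involution_lift]). For y in Dom(A) one has q[x,y] = <x,(A+I)y>, and A+I maps
Dom(A) onto H; since J commutes with A, the functional y |-> q[Jy,x] is
q-bounded on Dom(A), and the vector w of V representing it satisfies
<(A+I)y,w> = <(A+I)y,Jx>, whence w = Jx.

The form v is q-bounded, hence v[x,y] = q[x,Ly] with L bounded on V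
([bounded_form_operator]), and L anticommutes with J. Therefore T = J + L is
q-symmetric with ||Ty||^2 = ||y||^2 + ||Ly||^2 >= ||y||^2: the off-diagonal
perturbation can only increase the norm, whatever the size of beta. A
symmetric operator bounded from below is onto ([bounded_below_onto]).

As q[x,Ty] = b[x,y] + <x,Jy>, the equation (B+J)y = h for the operator B
defined by b becomes Ty = k, where k in V represents x |-> <x,h>; hence B+J is
onto H. Since B is symmetric and J is bounded and symmetric, this makes B
self-adjoint ([selfadjoint_of_onto]), and as B is the largest operator
satisfying the representation formula it is the only self-adjoint one
([represents_uniq]). Dom(B) is q-dense because a vector Tu' orthogonal to it
satisfies <u',h> = 0 for all h in H ([embedded_core]). *)

Set Implicit Arguments.
Unset Strict Implicit.
Unset Printing Implicit Defensive.

Import Order.TTheory GRing.Theory Num.Theory.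
Local Open Scope classical_set_scope.
Local Open Scope ring_scope.

(** * Real parts of complex numbers *)

Section RealPart.
Variable R : realType.
Implicit Types z w : R[i].

Lemma ReD z w : complex.Re (z + w) = complex.Re z + complex.Re w.
Proof. by case: z; case: w. Qed.

Lemma ReN z : complex.Re (- z) = - complex.Re z.
Proof. by case: z. Qed.

Lemma ReZ (t : R) z : complex.Re (t%:C%C * z) = t * complex.Re z.
Proof. by case: z => x y /=; rewrite mul0r subr0. Qed.

Lemma Re_conj z : complex.Re z^* = complex.Re z.
Proof. by case: z. Qed.

Lemma eqC_Re z w : complex.Re z = complex.Re w ->
  complex.Re ('i%C * z) = complex.Re ('i%C * w) -> z = w.
Proof.
by case: z w => a b [c d] /= ->; rewrite !mul0r !mul1r !sub0r => /oppr_inj ->.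
Qed.

Lemma ge0_Re z : 0 <= z -> z = (complex.Re z)%:C%C.
Proof. by case: z => x y; rewrite lecE /= => /andP[/eqP -> _]. Qed.

End RealPart.

(** * Hermitian forms and the Riesz representation *)

Section HermitianForms.
Variables (R : realType) (V : lmodType R[i]).
Implicit Types (q : V -> V -> R[i]) (x y z : V) (W : set V).

Record hermitian_form q : Prop := HermitianForm {
  hermitian_linear : forall z, scalar (q^~ z);
  hermitian_conj : forall x y, q x y = (q y x)^* }.

Definition sqn q x : R := complex.Re (q x x).

(** These are the inner products of Hilbert spaces, as a property of a form on a
bare complex vector space: completeness is stated through the squared norm, so
one space can carry several such forms without any topology on it. *)
Record hilbert_form q : Prop := HilbertForm {
  hilbert_hermitian :> hermitian_form q;
  sqn_ge0 : forall x, 0 <= sqn q x;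
  sqn_eq0 : forall x, sqn q x = 0 -> x = 0;
  sqn_complete : forall u : nat -> V,
    (forall e, 0 < e -> exists N, forall n m, (N <= n)%N -> (N <= m)%N ->
       sqn q (u n - u m) < e) ->
    exists x, forall e, 0 < e -> exists N, forall n, (N <= n)%N ->
       sqn q (u n - x) < e }.

Section Hermitian.
Variables (q : V -> V -> R[i]) (qH : hermitian_form q).

Lemma hformDl x y z : q (x + y) z = q x z + q y z.
Proof. by rewrite -[x]scale1r (hermitian_linear qH) mul1r scale1r. Qed.

Lemma hform0l z : q 0 z = 0.
Proof. by apply: (addrI (q 0 z)); rewrite -hformDl !addr0. Qed.

Lemma hformZl c x z : q (c *: x) z = c * q x z.
Proof. by rewrite -[c *: x]addr0 (hermitian_linear qH) hform0l addr0. Qed.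

Lemma hformNl x z : q (- x) z = - q x z.
Proof. by rewrite -scaleN1r hformZl mulN1r. Qed.

Lemma hformDr x y z : q z (x + y) = q z x + q z y.
Proof. by rewrite !(hermitian_conj qH z) hformDl rmorphD. Qed.

Lemma hformZr c x z : q z (c *: x) = c^* * q z x.
Proof. by rewrite !(hermitian_conj qH z) hformZl rmorphM. Qed.

Lemma hformNr x z : q z (- x) = - q z x.
Proof. by rewrite !(hermitian_conj qH z) hformNl rmorphN. Qed.

Lemma hformBr x y z : q z (x - y) = q z x - q z y.
Proof. by rewrite hformDr hformNr. Qed.

Lemma hform0r z : q z 0 = 0.
Proof. by rewrite (hermitian_conj qH) hform0l rmorph0. Qed.

Lemma Re_hformC x y : complex.Re (q x y) = complex.Re (q y x).
Proof. by rewrite (hermitian_conj qH) Re_conj. Qed.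

Lemma hform_sqnE x : q x x = (sqn q x)%:C%C.
Proof.
have := hermitian_conj qH x x; rewrite /sqn; case: (q x x) => s t [] /eqP.
by rewrite -addr_eq0 -mulr2n mulrn_eq0 /= => /eqP ->.
Qed.

Lemma sqnD x y : sqn q (x + y) = sqn q x + sqn q y + 2 * complex.Re (q x y).
Proof.
rewrite /sqn hformDl !hformDr !ReD (Re_hformC y x); ring.
Qed.

Lemma sqnN x : sqn q (- x) = sqn q x.
Proof. by rewrite /sqn hformNl hformNr opprK. Qed.

Lemma sqnB x y : sqn q (x - y) = sqn q x + sqn q y - 2 * complex.Re (q x y).
Proof. by rewrite sqnD sqnN hformNr ReN mulrN. Qed.

Lemma sqnZ (t : R) x : sqn q (t%:C%C *: x) = t ^+ 2 * sqn q x.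
Proof.
rewrite /sqn hformZl ReZ Re_hformC hformZl ReZ; ring.
Qed.

End Hermitian.

Lemma quadratic_ge0_linear0 (a b : R) : (forall t, 0 <= a * t ^+ 2 + b * t) -> b = 0.
Proof.
move=> h; pose c := `|a| + 1.
have c0 : 0 < c by rewrite /c; have := normr_ge0 a; lra.
have ac : a < c by rewrite /c; have := ler_norm a; lra.
have := h (- b / (2 * c)).
have -> : a * (- b / (2 * c)) ^+ 2 + b * (- b / (2 * c)) =
  b ^+ 2 * (a - 2 * c) / (4 * c ^+ 2) by field; lra.
rewrite pmulr_lge0; last by rewrite invr_gt0; nra.
move=> h2; apply/eqP; rewrite -sqrf_eq0 eq_le sqr_ge0 andbT; nra.
Qed.

(** The functional x |-> ||x||^2 - 2 Re f(x) is bounded below on W, any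
minimizing sequence in W is Cauchy by the parallelogram identity, and the first
variation vanishes at its limit w. No square root appears because boundedness
of f is expressed by 2 Re f(x) <= ||x||^2 + C, which scales to the usual
estimate. Since W need not be closed, w is only a limit of elements of W; the
case of f = q[.,x] then also yields the density criterion
[dense_of_orthogonal]. *)
Lemma riesz_subspace q (qH : hilbert_form q) W (W0 : W 0)
    (W_lin : forall c x y, W x -> W y -> W (c *: x + y)) (f : V -> R[i]) (C : R)
    (f_lin : forall c x y, W x -> W y -> f (c *: x + y) = c * f x + f y)
    (f_bound : forall x, W x -> 2 * complex.Re (f x) <= sqn q x + C) :
  exists w, [/\ forall e, 0 < e -> exists2 z, W z & sqn q (w - z) < e,
    sqn q w <= C & forall x, W x -> f x = q x w].
Proof.
pose Phi x := sqn q x - 2 * complex.Re (f x).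
pose E := [set Phi x | x in W].
have E_inf : has_inf E.
  split; first by exists (Phi 0), 0.
  by exists (- C) => _ [x Wx <-]; rewrite /Phi; have := f_bound x Wx; lra.
pose m := inf E.
have m_le x : W x -> m <= Phi x by move=> Wx; apply: (ge_inf E_inf.2); exists x.
have WD x y (t : R) : W x -> W y -> W (t%:C%C *: x + y) by exact: W_lin.
have PhiD u x t : W u -> W x -> Phi (t%:C%C *: x + u) = Phi u + t ^+ 2 * sqn q x
    + 2 * t * (complex.Re (q x u) - complex.Re (f x)).
  move=> Wu Wx; rewrite /Phi (sqnD qH) (sqnZ qH) (hformZl qH) ReZ f_lin // ReD ReZ.
  ring.
(* If u is almost minimal, moving from u in the direction x cannot gain
   more than e. *)
have var u x t e : W u -> W x -> Phi u < m + e ->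
    0 <= e + t ^+ 2 * sqn q x + 2 * t * (complex.Re (q x u) - complex.Re (f x)).
  move=> Wu Wx ue; have := m_le _ (WD x u t Wx Wu); rewrite PhiD //; lra.
have /choice[u u_min] : forall n : nat, exists u, W u /\ Phi u < m + n.+1%:R^-1.
  move=> n; have n0 : 0 < n.+1%:R^-1 :> R by rewrite invr_gt0.
  by have [_ [u Wu <-] ue] := inf_adherent n0 E_inf; exists u.
have small e : 0 < e -> exists N, forall n, (N <= n)%N -> n.+1%:R^-1 < e :> R.
  move=> e0; have [N] := ltr_add_invr e0.
  rewrite add0r => Ne; exists N => n Nn; apply: le_lt_trans Ne.
  by rewrite lef_pV2 ?posrE ?ltr0n // ler_nat.
have [|w u_w] := sqn_complete qH (u := u).
  move=> e e0; have [|N small_N] := small (e / 4); first by rewrite divr_gt0.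
  exists N => n k /small_N en /small_N ek.
  have [[Wn un] [Wk uk]] := (u_min n, u_min k).
  have Wnk : W (u n - u k).
    by rewrite addrC -scaleN1r; apply: W_lin.
  (* Moving from either of the two points to their midpoint. *)
  have := var _ _ (- 2^-1) _ Wn Wnk un; have := var _ _ 2^-1 _ Wk Wnk uk.
  have : sqn q (u n - u k) = complex.Re (q (u n - u k) (u n))
      - complex.Re (q (u n - u k) (u k)) by rewrite -ReN -ReD -(hformBr qH).
  move: (n.+1%:R^-1) (k.+1%:R^-1) en ek => dn dk en ek -> h1 h2; lra.
have app e : 0 < e -> exists v, [/\ W v, Phi v < m + e & sqn q (w - v) < e].
  move=> e0; have [N1 h1] := small e e0; have [N2 h2] := u_w e e0.
  have [Wn un] := u_min (maxn N1 N2); exists (u (maxn N1 N2)); split=> //.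
    by apply: lt_trans un _; rewrite ltrD2l h1 ?leq_maxl.
  by rewrite -opprB (sqnN qH) h2 ?leq_maxr.
have stat x : W x -> complex.Re (f x) = complex.Re (q x w).
  move=> Wx; apply/eqP; rewrite -subr_eq0; apply/eqP.
  apply: (@quadratic_ge0_linear0 (sqn q x)) => t.
  apply/ler_addgt0Pr => e e0; have [v [Wv ve we]] := app e e0.
  have := var v x (- t) e Wv Wx ve.
  (* This absorbs the error Re q[x,w-v] made by replacing v by the limit w. *)
  have := sqn_ge0 qH ((- t)%:C%C *: x + (w - v)).
  rewrite (sqnD qH) (sqnZ qH) (hformZl qH) ReZ (hformBr qH) ReD ReN sqrrN.
  nra.
exists w; split=> [e /app[v [Wv _ ve]]||x Wx]; first by exists v.
- apply/ler_addgt0Pr => e e0; have [v [Wv _ ve]] := app e e0.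
  have := f_bound v Wv; rewrite stat // (Re_hformC qH).
  have := sqnB qH w v; lra.
apply: eqC_Re; first exact: stat.
have Wix : W ('i%C *: x) by rewrite -[_ *: x]addr0; apply: W_lin.
have f0 : f 0 = 0 by have := f_lin (-1) 0 0 W0 W0; rewrite scaler0 addr0 mulN1r addNr.
have := stat _ Wix; rewrite (hformZl qH) => <-.
by have := f_lin 'i%C x 0 Wx W0; rewrite !addr0 f0 addr0 => ->.
Qed.

End HermitianForms.

Section HilbertForms.
Variables (R : realType) (V : lmodType R[i]).
Variables (q : V -> V -> R[i]) (qH : hilbert_form q).

Lemma form_nondeg y z : (forall x, q x y = q x z) -> y = z.
Proof.
move=> h; apply/eqP; rewrite -subr_eq0; apply/eqP; apply: (sqn_eq0 qH).
by rewrite /sqn (hformBr qH) h subrr.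
Qed.

Lemma hform_eq0 x : q x x = 0 -> x = 0.
Proof. by move=> qx0; apply: (sqn_eq0 qH); rewrite /sqn qx0. Qed.

Lemma Re_form_le x y : 2 * complex.Re (q x y) <= sqn q x + sqn q y.
Proof. by rewrite -subr_ge0 -(sqnB qH) (sqn_ge0 qH). Qed.

Lemma riesz (f : V -> R[i]) (C : R) (f_lin : scalar f)
    (f_bound : forall x, 2 * complex.Re (f x) <= sqn q x + C) :
  exists2 w, sqn q w <= C & forall x, f x = q x w.
Proof.
have [c x y _ _|x _|w [_ wC fw]] :=
  riesz_subspace qH (W := setT) I (fun _ _ _ _ _ => I) (f := f) (C := C).
- exact: f_lin.
- exact: f_bound.
by exists w => // x; apply: fw.
Qed.

(** The vector w that represents q[.,x] on W is a limit of elements of W, and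
x - w is orthogonal to W, so x = w. *)
Lemma dense_of_orthogonal (W : set V) (W0 : W 0)
    (W_lin : forall c x y, W x -> W y -> W (c *: x + y)) :
  (forall u, (forall x, W x -> q x u = 0) -> u = 0) ->
  forall x e, 0 < e -> exists2 z, W z & sqn q (x - z) < e.
Proof.
move=> W_orth x.
have [c y z _ _|y _|w [w_adh _ qw]] :=
  riesz_subspace qH W0 W_lin (f := q^~ x) (C := sqn q x).
- exact: (hermitian_linear qH).
- exact: Re_form_le.
suff -> : x = w by [].
apply/eqP; rewrite -subr_eq0; apply/eqP; apply: W_orth => y Wy.
by rewrite (hformBr qH) qw // subrr.
Qed.

End HilbertForms.

(** The symmetric operator T makes q[Tx,Ty] an inner product equivalent to q.
Representing x |-> q[Tx,f] in it gives y with T(Ty - f) = 0, and T is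
injective. *)
Lemma bounded_below_onto (R : realType) (V : lmodType R[i])
    (q : V -> V -> R[i]) (qH : hilbert_form q) (T : V -> V) (M : R)
    (T_sym : hermitian_form (fun x y => q x (T y)))
    (T_ge : forall x, sqn q x <= sqn q (T x))
    (T_le : forall x, sqn q (T x) <= M * sqn q x) :
  forall f, exists y, T y = f.
Proof.
pose q2 x y := q (T x) (T y).
have T_adj x y : q (T x) y = q x (T y).
  by rewrite [RHS](hermitian_conj T_sym) (hermitian_conj qH).
have q2E x y : q2 x y = q x (T (T y)) by rewrite /q2 T_adj.
have sqn2 x : sqn q2 x = sqn q (T x) by [].
have q2herm : hermitian_form q2.
  split=> [z c x y|x y]; last by rewrite /q2 (hermitian_conj qH).
  by rewrite !q2E (hermitian_linear qH).
have q2H : hilbert_form q2.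
  split=> // [x|x|u u_cauchy]; first exact: (sqn_ge0 qH).
    rewrite sqn2 => Tx0; apply: (sqn_eq0 qH); apply/eqP.
    by rewrite eq_le (sqn_ge0 qH) andbT -Tx0.
  have [|x u_x] := sqn_complete qH (u := u) => [e e0|].
    have [N uN] := u_cauchy e e0; exists N => n m Nn Nm.
    by apply: le_lt_trans (T_ge _) _; apply: uN.
  exists x => e e0; have c0 : 0 < `|M| + 1 by have := normr_ge0 M; lra.
  have [|N uN] := u_x (e / (`|M| + 1)); first by rewrite divr_gt0.
  exists N => n /uN; rewrite ltr_pdivlMr // => un; rewrite sqn2.
  apply: le_lt_trans (T_le _) _; apply: le_lt_trans un.
  have := ler_norm M; have := sqn_ge0 qH (u n - x); nra.
move=> f.
have f_lin : scalar (fun x => q (T x) f).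
  by move=> c x y; rewrite !T_adj (hermitian_linear qH).
have [x|y _ fy] := riesz q2H (C := sqn q f) f_lin; first exact: (Re_form_le qH).
exists y; apply/eqP; rewrite -subr_eq0; apply/eqP; apply: (sqn_eq0 qH).
apply/eqP; rewrite eq_le (sqn_ge0 qH) andbT; apply: le_trans (T_ge _) _.
suff -> : T (T y - f) = 0 by rewrite /sqn (hform0l qH).
apply: (form_nondeg qH) => x; rewrite -T_adj (hformBr qH) fy /q2 subrr.
by rewrite (hform0r qH).
Qed.

(** * The inner product of the ambient space *)

Section InnerProduct.
Variables (R : realType) (H : hilbertType R).
Notation ip := (@inner R H).
Implicit Types x y z : H.

Lemma inner_hermitian : hermitian_form ip.
Proof.
split=> [z c x y|x y]; first exact: linearPl.
by rewrite hermC expr0 mul1r.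
Qed.

Lemma sqn_innerE x : sqn ip x = complex.Re `|x| ^+ 2.
Proof.
rewrite /sqn -normr_inner; have := ge0_Re (normr_ge0 x).
by move: (complex.Re _) => r ->; rewrite -rmorphXn.
Qed.

Lemma normr_lt x (e : R) : 0 < e -> (`|x| < e%:C%C) = (sqn ip x < e ^+ 2).
Proof.
move=> e0; have xE := ge0_Re (normr_ge0 x).
rewrite sqn_innerE xE ltcR /= ltr_pXn2r // nnegrE ?(ltW e0) //.
by move: (normr_ge0 x); rewrite xE ler0c.
Qed.

Lemma pos_real (e : R[i]) : 0 < e -> e = (complex.Re e)%:C%C /\ 0 < complex.Re e.
Proof. by move=> e0; split; [exact/ge0_Re/ltW|rewrite -ltcR -(ge0_Re (ltW e0))]. Qed.

Lemma cvg_sqn_inner (u : nat -> H) x : u @ \oo --> x <->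
  forall e, 0 < e -> exists N, forall n, (N <= n)%N -> sqn ip (u n - x) < e.
Proof.
split=> [/cvgrPdist_lt u_x e e0|u_x].
  have [|N _ uN] := u_x (Num.sqrt e)%:C%C; first by rewrite ltcR sqrtr_gt0.
  exists N => n Nn; have := uN n Nn; rewrite distrC normr_lt ?sqrtr_gt0 //.
  by rewrite sqr_sqrtr // ltW.
apply/cvgrPdist_lt => e /pos_real[-> e0].
have [|N uN] := u_x (complex.Re e ^+ 2); first by rewrite exprn_gt0.
by exists N => // n Nn /=; rewrite distrC normr_lt //; apply: uN.
Qed.

Lemma inner_hilbert : hilbert_form ip.
Proof.
split=> [|x|x|u u_cauchy]; first exact: inner_hermitian.
- by rewrite sqn_innerE sqr_ge0.
- rewrite sqn_innerE => /eqP; rewrite sqrf_eq0 => /eqP x0.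
  by apply: normr0_eq0; rewrite (ge0_Re (normr_ge0 x)) x0.
suff /cvg_ex[x u_x] : cvg (u @ \oo) by exists x; apply/cvg_sqn_inner.
apply: cauchy_cvg; apply: cauchy_exP => e /pos_real[eE e0].
have [|N uN] := u_cauchy (complex.Re e ^+ 2); first by rewrite exprn_gt0.
exists (u N); exists N => // n /= Nn.
by rewrite -ball_normE /= eE normr_lt //; apply: uN.
Qed.

Lemma inner_cancel y z : (forall x, ip x y = ip x z) -> y = z.
Proof. exact: form_nondeg inner_hilbert _ _. Qed.

Lemma dense_sqnP (D : set H) : dense D <->
  forall x e, 0 < e -> exists2 z, D z & sqn ip (x - z) < e.
Proof.
split=> [D_dense x e e0|D_app U [x Ux] U_open].
  have se0 : 0 < Num.sqrt e by rewrite sqrtr_gt0.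
  have [||z [xz Dz]] := D_dense (ball x (Num.sqrt e)%:C%C).
  - by exists x; apply: ballxx; rewrite ltcR.
  - by apply: ball_open; rewrite ltcR.
  exists z => //; move: xz; rewrite -ball_normE /= normr_lt //.
  by rewrite sqr_sqrtr // ltW.
have /nbhs_ballP[e /pos_real[eE e0] eU] : nbhs x U by apply: open_nbhs_nbhs.
have [|z Dz xz] := D_app x (complex.Re e ^+ 2); first by rewrite exprn_gt0.
by exists z; split=> //; apply: eU; rewrite -ball_normE /= eE normr_lt.
Qed.

Lemma dense_orthogonal (D : set H) : dense D ->
  forall h, (forall x, D x -> ip x h = 0) -> h = 0.
Proof.
move=> /dense_sqnP D_app h Dh; apply: (sqn_eq0 inner_hilbert).
apply/eqP; rewrite eq_le (sqn_ge0 inner_hilbert) andbT.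
apply/ler_addgt0Pr => e /(D_app h)[z Dz].
rewrite (sqnB inner_hilbert) (Re_hformC inner_hilbert) Dh //=.
have := sqn_ge0 inner_hilbert z; lra.
Qed.

End InnerProduct.

(** * Off-diagonal perturbations of an involution *)

(** Polarization bounds Re v[x,y] by the squared norms of x and y; rescaling x
and y by reciprocal factors makes the coefficient of ||x||^2 at most 1, as the
Riesz representation requires. *)
Lemma bounded_form_operator (R : realType) (V : lmodType R[i])
    (q v : V -> V -> R[i]) (qH : hilbert_form q) (v_herm : hermitian_form v)
    (beta : R) (v_le : forall x, `|sqn v x| <= beta * sqn q x) :
  exists (L : V -> V) (M : R), (forall x y, v x y = q x (L y)) /\
    forall y, sqn q (L y) <= M * sqn q y.
Proof.
pose g := `|beta| + 1; pose M := g ^+ 3.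
have g_ge1 : 1 <= g by rewrite lerDr.
have g0 : g != 0 by lra.
have v_leg x : `|sqn v x| <= g * sqn q x.
  apply: le_trans (v_le x) _; apply: ler_wpM2r; first exact: (sqn_ge0 qH).
  by have := ler_norm beta; rewrite /g; lra.
have Re_v x y : 2 * complex.Re (v x y) <= sqn q x + M * sqn q y.
  have Re_v_sum z w : 2 * complex.Re (v z w) <= g * (sqn q z + sqn q w).
    have := v_leg (z + w); have := v_leg (z - w).
    rewrite (sqnB v_herm) (sqnB qH) (sqnD v_herm) (sqnD qH).
    rewrite !ler_norml => /andP[h1 _] /andP[_ h2]; nra.
  have := Re_v_sum (g^-1%:C%C *: x) (g%:C%C *: y).
  rewrite (hformZl v_herm) ReZ (Re_hformC v_herm) (hformZl v_herm) ReZ.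
  rewrite (Re_hformC v_herm) mulKf // !(sqnZ qH) => h.
  apply: le_trans h _.
  have -> : g * (g^-1 ^+ 2 * sqn q x + g ^+ 2 * sqn q y) =
    g^-1 * sqn q x + M * sqn q y by rewrite /M; field.
  rewrite lerD2r ler_piMl ?(sqn_ge0 qH) // invf_le1 //; lra.
(* The bound for the representing vector is the bound for the operator L. *)
have /choice[L L_v] y : exists w, sqn q w <= M * sqn q y /\ forall x, v x y = q x w.
  have [w w_le vw] := riesz qH (hermitian_linear v_herm y) (Re_v^~ y).
  by exists w.
by exists L, M; split=> [x y|y]; have [] := L_v y.
Qed.

(** With T = J + L, the cross term Re q[Jy,Ly] = Re v[Jy,y] vanishes because
v[Jy,y] = - v[y,Jy] is minus its own conjugate; hence
||Ty||^2 = ||y||^2 + ||Ly||^2. *)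
Lemma offdiagonal_form_operator (R : realType) (V : lmodType R[i])
    (q v : V -> V -> R[i]) (qH : hilbert_form q) (v_herm : hermitian_form v)
    (beta : R) (v_le : forall x, `|sqn v x| <= beta * sqn q x)
    (J : V -> V) (J_sym : forall x y, q (J x) y = q x (J y))
    (JJ : forall x, J (J x) = x)
    (v_offdiag : forall x y, v (J x) y = - v x (J y)) :
  exists T : V -> V, [/\ forall x y, q x (T y) = q x (J y) + v x y,
    hermitian_form (fun x y => q x (T y)) & forall f, exists y, T y = f].
Proof.
have [L [M [vL L_le]]] := bounded_form_operator qH v_herm v_le.
pose T y := J y + L y.
have TE x y : q x (T y) = q x (J y) + v x y by rewrite (hformDr qH) vL.
have T_herm : hermitian_form (fun x y => q x (T y)).
  split=> [z c x y|x y].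
    by rewrite !TE !(hermitian_linear qH, hermitian_linear v_herm) mulrDr addrACA.
  rewrite !TE rmorphD; congr (_ + _); last exact: hermitian_conj.
  by rewrite -J_sym (hermitian_conj qH).
have sqnJ y : sqn q (J y) = sqn q y by rewrite /sqn J_sym JJ.
have sqnT y : sqn q (T y) = sqn q y + sqn q (L y).
  rewrite (sqnD qH) sqnJ -vL v_offdiag.
  have := congr1 (@complex.Re R) (v_offdiag y y).
  rewrite (Re_hformC v_herm) !ReN; lra.
exists T; split=> //.
apply: (bounded_below_onto qH (M := 1 + M) T_herm) => y; rewrite sqnT.
  by have := sqn_ge0 qH (L y); lra.
by have := L_le y; lra.
Qed.

(** * Hilbert spaces embedded in the ambient space *)

Section Embedding.
Variables (R : realType) (H : hilbertType R) (V : lmodType R[i]).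
Variables (i : {linear V -> H}) (q : V -> V -> R[i]) (qH : hilbert_form q).
Hypothesis (i_inj : injective i).
Hypothesis (i_le : forall x, sqn (@inner R H) (i x) <= sqn q x).
Notation ip := (@inner R H).
Let ipH := inner_hilbert H.

Lemma embedded_riesz h : exists k, forall x, q x k = ip (i x) h.
Proof.
have [c x y|x|k _ hk] := @riesz _ _ _ qH (fun x => ip (i x) h) (sqn ip h).
- by rewrite linearP (hermitian_linear ipH).
- by apply: le_trans (Re_form_le ipH _ _) _; rewrite lerD2r.
by exists k.
Qed.

(** A vector u = Tu' that is q-orthogonal to the preimages under T of the Riesz
representatives k of all x |-> <x,h> satisfies, with Tz = k,
0 = q[z,Tu'] = q[Tz,u'] = <h,u'>; h = u' shows that u' = 0. *)
Lemma embedded_core (T : V -> V)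
    (T_herm : hermitian_form (fun x y => q x (T y)))
    (T_onto : forall f, exists y, T y = f) x e : 0 < e ->
  exists2 z, (exists h, forall x, q x (T z) = ip (i x) h) & sqn q (x - z) < e.
Proof.
move=> e0; pose W := [set z | exists h, forall x, q x (T z) = ip (i x) h].
suff W_orth u : (forall z, W z -> q z u = 0) -> u = 0.
  apply: (dense_of_orthogonal qH (W := W)) => //.
    by exists 0 => y; rewrite (hform0r T_herm) (hform0r ipH).
  move=> c y z [hy hyE] [hz hzE]; exists (c *: hy + hz) => t.
  rewrite (hformDr T_herm) (hformZr T_herm) hyE hzE.
  by rewrite (hformDr ipH) (hformZr ipH).
move=> uW; have [u' Tu'] := T_onto u.
have [k kE] := embedded_riesz (i u'); have [z Tz] := T_onto k.
have : q z u = 0 by apply: uW; exists (i u') => y; rewrite Tz.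
rewrite -Tu' (hermitian_conj T_herm) Tz kE => /eqP.
rewrite conjC_eq0 => /eqP/(hform_eq0 ipH) iu'0.
have /i_inj u'0 : i u' = i 0 by rewrite iu'0 linear0.
apply: (form_nondeg qH) => y.
by rewrite u'0 (hform0r T_herm) (hform0r qH).
Qed.

Section Involution.
Variables (A : operator H) (A_lin : linear_operator A).
Hypothesis A_dom : forall z, z \in odom A -> exists y, i y = z.
Hypothesis A_form : forall y g, (forall x, q x y = ip (i x) g) <->
  i y \in odom A /\ A (i y) + i y = g.
Variables (J : {linear H -> H}) (J_inv : selfadjoint_involution J).
Hypothesis JA : commutes_with J A.

(** If k represents x |-> <x,u> in q then k lies in Dom(A), because A + I is the
operator of the form q; hence q[k,u] = <u,u> vanishes. *)
Lemma operator_domain_orthogonal u :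
  (forall y, i y \in odom A -> q y u = 0) -> u = 0.
Proof.
move=> Wu; have [k kE] := embedded_riesz (i u).
have /A_form[kA _] := kE; have := Wu k kA.
rewrite (hermitian_conj qH) kE => /eqP.
rewrite conjC_eq0 => /eqP/(hform_eq0 ipH) iu0.
by apply: i_inj; rewrite iu0 linear0.
Qed.

(** J is assumed to preserve Dom(A) only. For x in the form domain, Jx is
identified with the Riesz representative of y |-> q[Jy,x], a functional bounded
on Dom(A) since J is a q-isometry there. *)
Lemma involution_lift : exists J' : V -> V,
  [/\ forall x, i (J' x) = J (i x), forall x y, q (J' x) y = q x (J' y)
    & forall x, J' (J' x) = x].
Proof.
have [_ J_sym JJ] := J_inv.
have [dom_sub A_linear] := A_lin.
pose g y := A (i y) + i y.
have gE x y : i y \in odom A -> q x y = ip (i x) (g y).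
  by move=> yA; have /A_form := conj yA (erefl (g y)); apply.
have domW c x y : i x \in odom A -> i y \in odom A -> i (c *: x + y) \in odom A.
  by move=> xA yA; rewrite linearP; apply: dom_sub.2.
(* (A + I) J y = J (A + I) y, read through the form q *)
have liftW y y' : i y \in odom A -> i y' = J (i y) ->
    forall x, q x y' = ip (i x) (J (g y)).
  move=> yA y'E; apply/A_form; rewrite y'E; split; first exact: JA.1.
  by rewrite -JA.2 // -linearD.
have step x : exists w, [/\ i w = J (i x), sqn q w <= sqn q x &
    forall y y', i y \in odom A -> i y' = J (i y) -> q y' x = q y w].
  pose W := [set y | i y \in odom A].
  pose f y := ip (J (g y)) (i x).
  have fE y y' : i y \in odom A -> i y' = J (i y) -> f y = q y' x.
    move=> yA y'E; rewrite (hermitian_conj qH) (liftW y y') //.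
    by rewrite /f (hermitian_conj ipH).
  have [|c y z yW zW|y yW|w [_ w_le fw]] :=
    @riesz_subspace _ _ q qH W _ domW f (sqn q x).
  - by rewrite /W /= linear0; exact: dom_sub.1.
  - rewrite /f /g linearP A_linear //.
    rewrite addrACA -scalerDr linearP; exact: (hermitian_linear ipH).
  - have [y' y'E] := A_dom (JA.1 _ yW); rewrite (fE y y') //.
    apply: le_trans (Re_form_le qH _ _) _; rewrite lerD2r.
    by rewrite /sqn (liftW y y') // y'E J_sym JJ -gE.
  exists w; split=> // [|y y' yA y'E]; last by rewrite -fw // (fE y y').
  apply: inner_cancel => h; have [k /A_form[kA gk]] := embedded_riesz h.
  have := fw k kA; rewrite (hermitian_conj qH) gE // -(hermitian_conj ipH).
  by rewrite /f /g gk -J_sym.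
have /choice[J' J'P] := step; exists J'.
have J'E x : i (J' x) = J (i x) by have [] := J'P x.
have J'_le x : sqn q (J' x) <= sqn q x by have [] := J'P x.
split=> // [x y|x]; last by apply: i_inj; rewrite !J'E.
(* The identity q[J'x,y] = q[x,J'y] holds for x in Dom(A) by construction;
   representing the left side on the whole space extends it, since only 0
   is q-orthogonal to Dom(A). *)
have J'_lin : scalar (fun x => q (J' x) y).
  move=> c z w; rewrite -(hermitian_linear qH); congr (q _ y).
  by apply: i_inj; rewrite J'E !linearP !J'E.
have [z|w _ qw] := riesz qH (C := sqn q y) J'_lin.
  by apply: le_trans (Re_form_le qH _ _) _; rewrite lerD2r.
rewrite qw; congr (q x _); apply/eqP; rewrite -subr_eq0; apply/eqP.
apply: operator_domain_orthogonal => z zA; rewrite (hformBr qH) -qw.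
by have [_ _ /(_ z (J' z) zA (J'E z)) ->] := J'P y; rewrite subrr.
Qed.

End Involution.
End Embedding.

(** * The form domain as a Hilbert space *)

Section FormSpace.
Variables (R : realType) (H : hilbertType R) (a : sform H).

(** The proof that the domain is a subspace is an argument so that the vector
space structure can be attached to the type. *)
Definition form_space (_ : submod_closed [in fdom a]) := {x : H | x \in fdom a}.

Variable a_sub : submod_closed [in fdom a].

HB.instance Definition _ := SubChoice.on (form_space a_sub).
HB.instance Definition _ := GRing.SubChoice_isSubLmodule.Build R[i] H _
  (form_space a_sub) (GRing.submod_closed_semi a_sub).

Definition form_space_val : {linear form_space a_sub -> H} := val.

Lemma form_space_val_mem (x : form_space a_sub) : form_space_val x \in fdom a.
Proof. exact: valP. Qed.

Lemma form_space_exists x : x \in fdom a -> exists y, form_space_val y = x.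
Proof. by move=> xa; exists (Sub x xa); rewrite [LHS]SubK. Qed.

Definition form_space_dot (x y : form_space a_sub) : R[i] :=
  form_add1 a (form_space_val x) (form_space_val y).

Lemma form_space_dotE x y : form_space_dot x y =
  a (form_space_val x) (form_space_val y) +
  inner (form_space_val x) (form_space_val y).
Proof. by []. Qed.

Hypotheses (a_form : sesquilinear_sform a) (a_sym : symmetric_sform a).
Hypotheses (a_ge0 : nonneg_sform a) (a_closed : closed_sform a).

Lemma form_space_sqnE x : sqn form_space_dot x =
  complex.Re (a (form_space_val x) (form_space_val x)) +
  sqn (@inner R H) (form_space_val x).
Proof. by rewrite /sqn form_space_dotE ReD. Qed.

Lemma form_space_le x :
  sqn (@inner R H) (form_space_val x) <= sqn form_space_dot x.
Proof.
rewrite form_space_sqnE lerDr.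
have := a_ge0 (form_space_val_mem x).
by rewrite lecE => /andP[].
Qed.

Lemma form_space_hilbert : hilbert_form form_space_dot.
Proof.
have ipH := inner_hilbert H; have [_ a_lin _] := a_form.
have mem := form_space_val_mem.
split=> [|x|x|u u_cauchy].
- split=> [z c x y|x y]; rewrite !form_space_dotE.
    rewrite linearP a_lin // (hermitian_linear ipH) mulrDr.
    by rewrite addrACA.
  rewrite rmorphD; congr (_ + _); first exact: a_sym.
  by rewrite (hermitian_conj ipH).
- exact: le_trans (sqn_ge0 ipH _) (form_space_le x).
- move=> x0; have /(sqn_eq0 ipH) ix0 : sqn (@inner R H) (form_space_val x) = 0.
    by apply/eqP; rewrite eq_le (sqn_ge0 ipH) andbT -x0 form_space_le.
  by apply: val_inj; rewrite [LHS]ix0 -(linear0 form_space_val).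
have aE (x y : form_space a_sub) (e : R) :
    (a (form_space_val (x - y)) (form_space_val (x - y)) < e%:C%C) =
    (complex.Re (a (form_space_val (x - y)) (form_space_val (x - y))) < e).
  by rewrite [in LHS](ge0_Re (a_ge0 (mem (x - y)))) ltcR.
pose w n := form_space_val (u n).
have wB n m : w n - w m = form_space_val (u n - u m) by rewrite linearB.
have [e e0|x u_x] := sqn_complete ipH (u := w).
  have [N uN] := u_cauchy e e0; exists N => n m Nn Nm; rewrite wB.
  by apply: le_lt_trans (form_space_le _) (uN n m Nn Nm).
have [n||e e0|xa au_x] := a_closed (u := w) (x := x).
- exact: mem.
- exact/cvg_sqn_inner.
- have [N uN] := u_cauchy e e0; exists N => n m Nn Nm.
  rewrite wB aE; apply: le_lt_trans (uN n m Nn Nm).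
  by rewrite form_space_sqnE lerDl (sqn_ge0 ipH).
have [y yx] := form_space_exists xa; exists y => e e0.
have wx n : w n - x = form_space_val (u n - y) by rewrite linearB yx.
have e20 : 0 < e / 2 by rewrite divr_gt0.
have [[N uN] [M uM]] := (u_x _ e20, au_x _ e20).
exists (maxn N M) => n; rewrite geq_max => /andP[/uN + /uM].
rewrite wx aE form_space_sqnE; lra.
Qed.

End FormSpace.

(** * The self-adjoint operator of a symmetric form *)

Section Operators.
Variables (R : realType) (H : hilbertType R).
Notation ip := (@inner R H).
Let ipH := inner_hilbert H.

(** If (y,z) is in the graph of the adjoint of B, pick y' in Dom(B) with
(B+J)y' = z + Jy. Then y - y' is orthogonal to the range of B+J, so y = y'. *)
Lemma selfadjoint_of_onto (B : operator H) (J : H -> H)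
    (B_lin : linear_operator B) (B_dense : dense (odom B))
    (B_sym : forall x y, x \in odom B -> y \in odom B -> ip (B x) y = ip x (B y))
    (J_sym : forall x y, ip (J x) y = ip x (J y))
    (onto : forall h, exists2 y, y \in odom B & B y + J y = h) :
  selfadjoint B.
Proof.
split=> // y z; split=> [yz|[yB <-] x xB]; last exact: B_sym.
have [y' y'B By'] := onto (z + J y).
suff yE : y = y' by split; rewrite yE //; apply: (addIr (J y')); rewrite By' yE.
apply: inner_cancel => x; have [u uB <-] := onto x.
by rewrite !(hformDl ipH) yz // B_sym // !J_sym -!(hformDr ipH) By'.
Qed.

(** The largest operator B with b[x,y] = <x,By>; the vector h chosen as By is
unique once the form domain is dense. *)
Definition form_operator (b : sform H) : operator H :=
  Operator [set y | y \in fdom b /\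
      exists h, forall x, x \in fdom b -> b x y = ip x h]
    (fun y => xget 0 [set h | forall x, x \in fdom b -> b x y = ip x h]).

Section FormOperator.
Variables (b : sform H) (b_form : sesquilinear_sform b).
Hypotheses (b_sym : symmetric_sform b) (b_dense : dense (fdom b)).

Lemma form_operatorP y h : y \in odom (form_operator b) /\ form_operator b y = h <->
  y \in fdom b /\ forall x, x \in fdom b -> b x y = ip x h.
Proof.
have xgetE z k : (forall x, x \in fdom b -> b x z = ip x k) ->
    forall x, x \in fdom b -> b x z = ip x (form_operator b z).
  pose P := [set h | forall x, x \in fdom b -> b x z = ip x h].
  by move=> zk; apply: (@xgetPex _ 0 P); exists k.
split=> [[/set_mem[yb [k yk]] <-]|[yb yh]]; first by split=> //; apply: xgetE yk.
split; first by apply/mem_set; split=> //; exists h.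
apply/eqP; rewrite -subr_eq0; apply/eqP; apply: (dense_orthogonal b_dense) => x xb.
by rewrite (hformBr ipH) -(xgetE y h) ?yh ?subrr //; apply/mem_set.
Qed.

Lemma form_operator_graph y : y \in odom (form_operator b) ->
  y \in fdom b /\ forall x, x \in fdom b -> b x y = ip x (form_operator b y).
Proof. by move=> yB; apply/form_operatorP. Qed.

Lemma form_operator_linear : linear_operator (form_operator b).
Proof.
have [[b0 b_lin] _ b_antilin] := b_form.
have lin c x y : x \in odom (form_operator b) -> y \in odom (form_operator b) ->
    c *: x + y \in odom (form_operator b) /\
    form_operator b (c *: x + y) = c *: form_operator b x + form_operator b y.
  move=> /form_operator_graph[xb bx] /form_operator_graph[yb bY].
  apply/form_operatorP; split=> [|z zb]; first exact: b_lin.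
  by rewrite b_antilin // bx // bY // (hformDr ipH) (hformZr ipH).
split; last by move=> c x y xB yB; have [] := lin c x y xB yB.
split; last by move=> c x y xB yB; have [] := lin c x y xB yB.
suff [] : 0 \in odom (form_operator b) /\ form_operator b 0 = 0 by [].
apply/form_operatorP; split=> // x xb; rewrite (hform0r ipH).
have := b_antilin (-1) 0 0 x b0 b0 xb; rewrite scaler0 addr0.
by rewrite rmorphN1 mulN1r addNr.
Qed.

Lemma form_operator_sym x y : x \in odom (form_operator b) ->
  y \in odom (form_operator b) -> ip (form_operator b x) y = ip x (form_operator b y).
Proof.
move=> /form_operator_graph[xb bx] /form_operator_graph[yb bY].
by rewrite -bY // b_sym // bx // (hermitian_conj ipH).
Qed.

(** An operator representing b is a restriction of [form_operator b], and a
self-adjoint operator has no proper symmetric extension. *)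
Lemma represents_uniq (B' : operator H) :
  represents b B' -> same_operator (form_operator b) B'.
Proof.
move=> [[_ _ B'_adj] B'b bB'].
have sub y : y \in odom B' -> y \in odom (form_operator b) /\ form_operator b y = B' y.
  move=> yB'; apply/form_operatorP; split=> [|x xb]; last exact: bB'.
  by apply/mem_set/B'b/set_mem.
have sup y : y \in odom (form_operator b) -> y \in odom B' /\ B' y = form_operator b y.
  move=> yB; apply/B'_adj => x /sub[xB <-]; exact: form_operator_sym.
split; last by move=> y /sup[].
by apply/seteqP; split=> y /mem_set; [case/sup|case/sub] => /set_mem.
Qed.

End FormOperator.

End Operators.

(** * The operator associated with a form through its square root *)

Section Associated.
Variables (R : realType) (H : hilbertType R) (a : sform H) (A : operator H).
Hypothesis aA : associated a A.
Notation ip := (@inner R H).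
Let ipH := inner_hilbert H.

Lemma associated_sym : symmetric_sform a.
Proof.
have [S [_ _ aE]] := aA; move=> x y xa ya.
by rewrite !aE // (hermitian_conj ipH).
Qed.

(** The first representation theorem for a: self-adjointness of S = A^(1/2)
turns the weak equation <Sx,Sy> = <x,g-y> into S(Sy) = g - y. *)
Lemma associated_graph y g : y \in fdom a ->
  (forall x, x \in fdom a -> form_add1 a x y = ip x g) <->
  y \in odom A /\ A y + y = g.
Proof.
have [S [[[_ _ S_adj] _ [A_dom AE]] a_dom aE]] := aA => ya.
split=> [ay|[yA <-] x xa].
  have [SyS SSy] : S y \in odom S /\ S (S y) = g - y.
    apply/S_adj => x; rewrite -a_dom => xa.
    by rewrite -aE // (hformBr ipH) -ay //= addrK.
  have yA : y \in odom A.
    by rewrite A_dom; apply/mem_set; split=> //; rewrite -a_dom.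
  by rewrite AE //= SSy subrK.
have := yA; rewrite {1}A_dom => /set_mem[/= yS SyS].
rewrite /= aE // AE // (hformDr ipH); congr (_ + _).
by have /S_adj := conj SyS (erefl (S (S y))); apply; rewrite -a_dom.
Qed.

Lemma associated_dom y : y \in odom A -> y \in fdom a.
Proof.
have [S [[_ _ [A_dom _]] -> _]] := aA.
by rewrite A_dom => /set_mem[].
Qed.

End Associated.

(** * The representation theorem *)

Theorem theorem2p8 (R : realType) (H : hilbertType R)
  (a : sform H) (a_form : sesquilinear_sform a) (a_dense : dense (fdom a))
  (a_ge0 : nonneg_sform a) (a_closed : closed_sform a)
  (A : operator H) (A_sa : selfadjoint A) (A_ge0 : nonneg_operator A)
  (aA : associated a A)
  (J : {linear H -> H}) (J_inv : selfadjoint_involution J)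
  (JA : commutes_with J A)
  (v : sform H) (v_form : sesquilinear_sform v) (v_sym : symmetric_sform v)
  (av : fdom a `<=` fdom v)
  (beta : R)
  (v_bound : forall x : H, x \in fdom a ->
     `|v x x| <= beta%:C%C * form_add1 a x x)
  (v_offdiag : forall x y : H, x \in fdom a -> y \in fdom a ->
     v (J x) y = - v x (J y)) :
  let b := indefinite_form a v J in
  exists B : operator H,
    [/\ represents b B,
        forall B' : operator H, represents b B' -> same_operator B B' &
        form_core a (odom B)].
Proof.
move=> b; have b_dense : dense (fdom b) by []; have a_sym := associated_sym aA.
have [a_sub a_lin a_antilin] := a_form; have [_ v_lin v_antilin] := v_form.
have ipH := inner_hilbert H; have [_ J_sym _] := J_inv.
pose V := form_space a_sub; pose i := form_space_val a_sub.
pose q : V -> V -> R[i] := @form_space_dot _ _ _ a_sub.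
have qH : hilbert_form q by exact: form_space_hilbert.
have i_le x : sqn (@inner R H) (i x) <= sqn q x by exact: form_space_le.
have i_inj : injective i by exact: val_inj.
have i_mem x : i x \in fdom a by exact: form_space_val_mem.
have i_ex x : x \in fdom a -> exists y, i y = x by exact: form_space_exists.
have qE x y : q x y = a (i x) (i y) + inner (i x) (i y) by [].
have mem_v x : x \in fdom a -> x \in fdom v by move=> /set_mem/av/mem_set.
have A_graph y g : (forall x, q x y = inner (i x) g) <->
    i y \in odom A /\ A (i y) + i y = g.
  split=> [yg|/(associated_graph aA g (i_mem y)) yg x]; last exact: yg.
  by apply/(associated_graph aA) => // x /i_ex[z <-]; apply: yg.
have A_dom z : z \in odom A -> exists y, i y = z.
  by move=> /(associated_dom aA)/i_ex.
have [A_lin _ _] := A_sa.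
have [J' [J'E J'_sym J'J']] :=
  involution_lift qH i_inj i_le A_lin A_dom A_graph J_inv JA.
have J_dom x : x \in fdom a -> J x \in fdom a.
  by move=> /i_ex[y <-]; rewrite -J'E.
pose w (x y : V) := v (i x) (i y).
have w_herm : hermitian_form w.
  split=> [z c x y|x y]; last by apply: v_sym; apply: mem_v.
  by rewrite /w linearP v_lin //; apply: mem_v.
have w_le x : `|sqn w x| <= beta * sqn q x.
  have := v_bound _ (i_mem x); rewrite -/(w x x) -[form_add1 _ _ _]/(q x x).
  move=> /(le_trans (normc_ge_Re _)).
  by rewrite lecE ReZ => /andP[].
have w_offdiag x y : w (J' x) y = - w x (J' y).
  by rewrite /w !J'E v_offdiag.
have [T [TE T_herm T_onto]] :=
  offdiagonal_form_operator qH w_herm w_le J'_sym J'J' w_offdiag.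
have bE x y : q x (T y) = b (i x) (i y) + inner (i x) (J (i y)).
  by rewrite TE qE J'E /= addrAC.
have b_sym : symmetric_sform b.
  move=> _ _ /i_ex[x <-] /i_ex[y <-].
  have J_conj : inner (i x) (J (i y)) = (inner (i y) (J (i x)))^*.
    by rewrite -J_sym (hermitian_conj ipH).
  by have := hermitian_conj T_herm x y; rewrite !bE J_conj rmorphD => /addIr.
have b_form : sesquilinear_sform b.
  split=> // c x y z xa ya za.
    by rewrite /= a_lin ?J_dom // v_lin ?mem_v // mulrDr addrACA.
  by rewrite /= linearP a_antilin ?J_dom // v_antilin ?mem_v // mulrDr addrACA.
pose B := form_operator b.
have B_intro y h : (forall x, q x (T y) = inner (i x) h) ->
    i y \in odom B /\ B (i y) = h - J (i y).
  move=> yh; apply/form_operatorP => //; split=> // _ /i_ex[x <-].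
  by rewrite (hformBr ipH) -yh bE addrK.
have core x e : 0 < e -> exists2 z, i z \in odom B & sqn q (x - z) < e.
  move=> e0; have [z [h /B_intro[zB _]] xz] :=
    embedded_core qH i_inj i_le T_herm T_onto x e0.
  by exists z.
have B_dense : dense (odom B).
  apply/dense_sqnP => x e e0; have e40 : 0 < e / 4 by rewrite divr_gt0.
  have [y /mem_set/i_ex[{}y <-] xy] := (dense_sqnP _).1 a_dense x _ e40.
  have [z zB yz] := core y _ e40; exists (i z); first exact: set_mem.
  have := sqn_ge0 ipH (x - i y - (i y - i z)).
  have -> : x - i z = (x - i y) + (i y - i z) by rewrite addrA subrK.
  rewrite (sqnB ipH (x - i y)) (sqnD ipH (x - i y)).
  have := i_le (y - z); rewrite linearB; lra.
have B_sa : selfadjoint B.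
  apply: (selfadjoint_of_onto (J := J)) => //.
  - exact: form_operator_linear.
  - exact: form_operator_sym.
  - move=> h; have [k kE] := embedded_riesz qH i_le h; have [y Ty] := T_onto k.
    have [|yB By] := B_intro y h; first by rewrite Ty.
    by exists (i y) => //; rewrite By subrK.
exists B; split.
- split=> // [y [/set_mem //]|x y xa yB].
  by have [_ ->] := form_operator_graph b_dense yB.
- by move=> B'; apply: represents_uniq.
- split=> [y [/set_mem //]|x /i_ex[{}x <-] e e0].
  have [|z zB xz] := core x (e ^+ 2); first by rewrite exprn_gt0.
  exists (i z) => //; rewrite /form_norm -linearB.
  rewrite -[form_add1 _ _ _]/(q (x - z) (x - z)).
  rewrite (hform_sqnE qH) -[ltRHS]sqrCK ?ler0c ?ltW // -rmorphXn /=.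
  by rewrite ltr_sqrtC ?qualifE /= ?ler0c ?(sqn_ge0 qH) ?sqr_ge0 // ltcR.
Qed.
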